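(* Let $r, a \in \mathbb{Z}_{\geq 1}$ and let $s \geq 2r+1$ be an integer, and let $T = T^a_{(r)}$. Then \[ \mathrm{ex}_\Pi\big(s, \Sigma_T(s)\big) = \mathrm{ex}_\Pi\big(s, \Sigma_T(s)+1\big) = \dotsb = \mathrm{ex}_\Pi\big(s, \Sigma_T(s) + \lfloor (s-1)/r\rfloor - 1\big). \] In particular, for all integers $0 \leq t \leq \lfloor (s-1)/r \rfloor - 1$, \[ \mathrm{ex}_\Pi\big(s, \Sigma_T(s) + t\big) = a\Big(\frac{a+1}{a}\Big)^{(r-1)/r}. \]
   Context: A multigraph $G=(V,w)$ is a finite vertex set $V$ with $w\colon\binom V2\to\mathbb{Z}_{\ge0}$; $e(X)=\sum_{uv\in\binom X2}w(uv)$ and $P(G)=\prod_{uv\in\binom V2}w(uv)$. For integers $s\ge2,q\ge0$, $G$ is an $(s,q)$-graph if $e(X)\le q$ for every $s$-set $X$. $\mathrm{ex}_\Pi(n,s,q)$ is the maximum of $P(G)$ over $(s,q)$-graphs on $[n]$, and $\mathrm{ex}_\Pi(s,q)=\lim_{n\to\infty}\mathrm{ex}_\Pi(n,s,q)^{1/\binom n2}$ (the limit exists). A pattern $P$ on a finite set $V(P)$ assigns non-negative integer multiplicities to vertices (loops) and pairs; a blow-up of $P$ on $[n]$ is a multigraph on $[n]$ with a map $f\colon[n]\to V(P)$ (not necessarily surjective) such that $w(vv')=P(\{f(v),f(v')\})$ for distinct $v,v'$ (a loop multiplicity if $f(v)=f(v')$). $\Sigma_P(n)$ is the maximum of $e(G)$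 over blow-ups $G$ of $P$ on $[n]$. The pattern $T^a_{(r)}$ has vertex set $[r]$, every loop of multiplicity $a$ and every pair of distinct vertices of multiplicity $a+1$. *)

(* Defs.v *)
From HB Require Import structures.
From mathcomp Require Import all_boot all_order all_algebra.
From mathcomp Require Import all_classical all_reals all_analysis.

Set Implicit Arguments.
Unset Strict Implicit.
Unset Printing Implicit Defensive.

Import Order.TTheory GRing.Theory Num.Theory.
Import numFieldNormedType.Exports.

Local Open Scope classical_set_scope.
Local Open Scope ring_scope.

(* The maximum of a set of naturals; the default 0 is taken only when the set
   is empty or unbounded. *)
Definition maximum (A : set nat) : nat :=
  xget 0%N [set m | A m /\ forall k, A k -> (k <= m)%N].

(* The weight function w of a multigraph on V; only its values on 2-element
   sets are ever used. *)
Definition multigraph (V : finType) := {set V} -> nat.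

Definition edge_sum (V : finType) (w : multigraph V) (X : {set V}) : nat :=
  (\sum_(A : {set V} | (A \subset X) && (#|A| == 2)) w A)%N.

Definition edge_prod (V : finType) (w : multigraph V) : nat :=
  (\prod_(A : {set V} | #|A| == 2) w A)%N.

Definition sq_graph (V : finType) (s q : nat) (w : multigraph V) : Prop :=
  forall X : {set V}, #|X| = s -> (edge_sum w X <= q)%N.

(* For n < s every multigraph on [n] is an (s,q)-graph and the maximum need
   not exist; these finitely many n do not affect the limit below. *)
Definition ex_Pi_n (n s q : nat) : nat :=
  maximum [set edge_prod w | w in [set w : multigraph 'I_n | sq_graph s q w]].

(* If the sequence did not converge, lim would return 0. *)
Definition ex_Pi (R : realType) (s q : nat) : R :=
  lim ((fun n : nat => (ex_Pi_n n s q)%:R `^ ('C(n, 2)%:R)^-1 : R) @ \oo).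

(* The loop at x has multiplicity P [set x] and the pair xy has multiplicity
   P [set x; y]; other values of P are never used. *)
Definition pattern (U : finType) := {set U} -> nat.

Definition is_blowup (U V : finType) (P : pattern U) (w : multigraph V) : Prop :=
  exists f : V -> U,
    forall v v' : V, v != v' -> w [set v; v']%SET = P [set f v; f v']%SET.

Definition Sigma_pat (U : finType) (P : pattern U) (n : nat) : nat :=
  maximum [set edge_sum w [set: 'I_n]%SET
          | w in [set w : multigraph 'I_n | is_blowup P w]].

Definition T_pat (r a : nat) : pattern 'I_r :=
  fun A => if #|A| == 1%N then a else a.+1.

Arguments T_pat r a _ : clear implicits.

(* Main.v *)
(** Put [D/r = a + (r-1)/r], the asymptotic density of the blow-ups of [T].
    Upper bound: if every vertex of a large multigraph had degree more than
    [(D/r) n + q], then by averaging any [k]-set [X] could be extended by a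
    vertex sending more than [(D/r) k] to [X].  Growing a set greedily in this
    way beats the increments of [Sigma_T] by one each time [r] divides
    [k >= 1], so it yields an [s]-set of weight at least
    [Sigma_T(s) + (s-1) %/ r], which is forbidden.  Hence some vertex always has
    low degree; deleting such vertices one by one bounds the edge sum by
    [(D/r) 'C(n,2) + O(n)], and since [ln] restricted to the integers lies below
    its chord through [a] and [a + 1], the edge product is bounded accordingly.
    Lower bound: colour the vertex [i] by [i %% r]; this blow-up also attains
    [Sigma_T(s)]. *)

Require Import Defs.
From HB Require Import structures.
From mathcomp Require Import all_boot all_order all_algebra.
From mathcomp Require Import all_classical all_reals all_analysis.
From mathcomp Require Import zify ring lra.
Set Implicit Arguments.
Unset Strict Implicit.
Unset Printing Implicit Defensive.

Import Order.TTheory GRing.Theory Num.Theory.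
Import numFieldNormedType.Exports.
Local Open Scope classical_set_scope.
Local Open Scope ring_scope.

(** * Edge sums and degrees inside a vertex set *)

Section EdgeSum.
Import boot.fintype boot.finset.
Local Open Scope nat_scope.
Variables (V : finType) (w : multigraph V).
Implicit Types (U X Y : {set V}) (v : V).

Definition degree_in U v : nat := \sum_(u in U :\ v) w [set v; u]%SET.

Lemma edge_sumD1 U v : v \in U ->
  edge_sum w U = edge_sum w (U :\ v) + degree_in U v.
Proof.
move=> vU; rewrite /edge_sum /degree_in.
rewrite (bigID (fun A : {set V} => v \notin A)) /=; congr (_ + _).
  apply: eq_bigl => A; rewrite subsetD1.
  by case: (A \subset U) (v \notin A) (#|A| == 2) => [] [] [].
(* The pairs of [U] through [v] are indexed by their other end. *)
rewrite -(big_imset (h := fun u => [set v; u]%SET) (fun A => w A)) /=; last first.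
  move=> x y /[!inE] /andP[xv _] /andP[yv _] /setP /(_ x).
  by rewrite !inE eqxx orbT (negbTE xv) /= => /esym/eqP.
apply: eq_bigl => A; rewrite negbK; apply/idP/imsetP.
  move=> /andP[/andP[AU A2] vA].
  have /eqP/cards1P[u Au] : #|A :\ v| = 1 by move: A2; rewrite (cardsD1 v) vA => /eqP [].
  have uA : u \in A :\ v by rewrite Au inE.
  exists u; first by move: uA; rewrite !inE => /andP[-> /(subsetP AU)].
  by rewrite -(setD1K vA) Au.
move=> [u /[!inE] /andP[uv uU] ->].
by rewrite cards2 (eq_sym v) uv !inE eqxx subUset !sub1set vU uU.
Qed.

Lemma edge_sumS X Y : X \subset Y -> edge_sum w X <= edge_sum w Y.
Proof.
move=> XY; rewrite /edge_sum [leqRHS](bigID (fun A : {set V} => A \subset X)) /=.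
apply: leq_trans (leq_addr _ _); rewrite leq_eqVlt; apply/orP; left; apply/eqP.
apply: eq_bigl => A; case AX: (A \subset X); rewrite ?andbF //.
by rewrite (subset_trans AX XY) andbT.
Qed.

Lemma degree_in_le U v : v \in U -> degree_in U v <= edge_sum w U.
Proof. by move=> vU; rewrite (edge_sumD1 vU) leq_addl. Qed.

Lemma edge_sum0 : edge_sum w set0 = 0.
Proof.
rewrite /edge_sum big_pred0 // => A; rewrite subset0.
by case: eqP => // ->; rewrite cards0.
Qed.

Lemma card_superset X k : #|X| <= k <= #|V| ->
  exists2 Y : {set V}, X \subset Y & #|Y| = k.
Proof.
elim: k => [|k IH] /andP[Xk kV].
  by exists X => //; apply/eqP; rewrite -leqn0.
move: Xk; rewrite leq_eqVlt => /orP[/eqP Xk|Xk]; first by exists X.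
have [|Y XY Yk] := IH; first by rewrite -ltnS Xk ltnW.
have : exists x, x \notin Y.
  apply/existsP; apply: contraLR kV.
  rewrite negb_exists -leqNgt -Yk -cardsT => /forallP H.
  by apply/subset_leq_card/subsetP => x _; move: (H x); rewrite negbK.
case=> x xY; exists (x |: Y); last by rewrite cardsU1 xY Yk.
by apply: subset_trans XY _; apply: subsetUr.
Qed.

Lemma sq_graph_small s q X : sq_graph s q w -> s <= #|V| -> #|X| <= s ->
  edge_sum w X <= q.
Proof.
move=> sq sV Xs; have [|Y XY Yk] := @card_superset X s; first by rewrite Xs.
exact: leq_trans (edge_sumS XY) (sq _ Yk).
Qed.

(** Bounds the edge products on at least [s] vertices, so that the maximum in [ex_Pi_n] is attained
    there. *)
Lemma sq_graph_weight s q (A : {set V}) : sq_graph s q w -> 2 <= s <= #|V| ->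
  #|A| = 2 -> w A <= q.
Proof.
move=> sq /andP[s2 sV] A2; have As : #|A| <= s by rewrite A2.
apply: leq_trans (sq_graph_small sq sV As).
by rewrite /edge_sum (bigD1 A) ?subxx ?A2 //= leq_addr.
Qed.

End EdgeSum.

(** In a balanced [r]-colouring built vertex by vertex, vertex [j] sends [a] to each of the [j]
    earlier vertices, and 1 more to all but the [j %/ r] of its own colour. *)
Definition turan_sum (r a n : nat) : nat :=
  (\sum_(j < n) (a * j + (j - j %/ r)))%N.

(** * Upper bound on the edge sum of an (s,q)-graph *)

Section Density.
Import boot.fintype boot.finset.
Local Open Scope nat_scope.
Variables (V : finType) (w : multigraph V) (r a s q : nat).
Hypotheses (r_gt0 : 0 < r) (a_gt0 : 0 < a) (s_gt0 : 0 < s) (sV : s <= #|V|).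
Hypothesis sq : sq_graph s q w.
Let D := a * r + (r - 1).

(* Double count the weight between [X] and [U :\: X]; the weight that a vertex
   of [X] sends inside [X] is at most [q], which the degree bound absorbs. *)
Lemma heavy_extension (U X : {set V}) : X \subset U -> 0 < #|X| < s ->
  (forall v, v \in U -> D * #|U| + r * q <= r * degree_in w U v) ->
  exists2 v, v \in U :\: X & D * #|X| < r * degree_in w (v |: X) v.
Proof.
move=> XU /andP[X0 Xs] deg.
suff: ~~ [forall (v | v \in U :\: X), r * degree_in w (v |: X) v <= D * #|X|].
  by rewrite negb_forall_in => /exists_inP[v vUX]; rewrite -ltnNge => ?; exists v.
apply/negP => /forall_inP small.
have dE v : v \in U :\: X -> degree_in w (v |: X) v = \sum_(x in X) w [set x; v]%SET.
  rewrite inE => /andP[vX _]; rewrite /degree_in setU1K //.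
  by apply: eq_bigr => x _; rewrite setUC.
have out : \sum_(v in U :\: X) r * degree_in w (v |: X) v <= D * #|X| * (#|U| - #|X|).
  apply: leq_trans (leq_sum _ small) _; rewrite sum_nat_const cardsD (setIidPr XU).
  by rewrite mulnC.
have inn : \sum_(x in X) r * degree_in w U x <=
    \sum_(v in U :\: X) r * degree_in w (v |: X) v + #|X| * (r * q).
  rewrite -big_distrr -[X in _ <= X + _]big_distrr /= [#|X| * _]mulnCA -mulnDr.
  rewrite leq_mul2l (eq_bigr _ dE) exchange_big /= -sum_nat_const -big_split /=.
  apply/orP; right; apply: leq_sum => x xX.
  rewrite {1}/degree_in (bigID (mem X)) /= addnC leq_add //.
    rewrite leq_eqVlt; apply/orP; left; apply/eqP; apply: eq_bigl => y.
    by rewrite !inE; case: eqP => [->|_] /=; rewrite ?xX //= andbC.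
  apply: leq_trans (sq_graph_small sq sV (ltnW Xs)).
  apply: leq_trans (degree_in_le w xX); rewrite leq_eqVlt; apply/orP; left; apply/eqP.
  apply: eq_bigl => y; rewrite !inE; case yX: (y \in X); rewrite ?andbF //.
  by rewrite (subsetP XU _ yX) !andbT.
have low : #|X| * (D * #|U| + r * q) <= \sum_(x in X) r * degree_in w U x.
  by rewrite -sum_nat_const; apply: leq_sum => x xX; apply: deg; apply: (subsetP XU).
have cXU := subset_leq_card XU.
have D0 : 0 < D by rewrite /D addn_gt0 muln_gt0 a_gt0 r_gt0.
(* The terms [#|X| * (r * q)] cancel, leaving [D * #|X| * #|U| <= D * #|X| * (#|U| - #|X|)], which
   is impossible for nonempty [X]. *)
move: (leq_trans low inn) out; rewrite mulnDr leq_add2r => /leq_trans H /H {H}.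
rewrite mulnA [#|X| * D]mulnC leq_mul2l muln_eq0.
by move: X0 D0 cXU; clear; lia.
Qed.

(** The bound is [turan_sum r a k.+1 + k %/ r], written without the division: the last summand of
    [turan_sum r a k.+1] is [a * k + (k - k %/ r)]. Repeated heavy extensions of a single vertex
    reach it. *)
Lemma dense_subset (U : {set V}) k : 0 < #|U| -> k < s ->
  (forall v, v \in U -> D * #|U| + r * q <= r * degree_in w U v) ->
  exists2 X : {set V}, X \subset U /\ #|X| = k.+1
    & turan_sum r a k + a * k + k <= edge_sum w X.
Proof.
move=> U0 + deg; elim: k => [|k IH] ks.
  case/card_gt0P: U0 => x xU; exists [set x]%SET; first by rewrite sub1set cards1.
  by rewrite /turan_sum big_ord0 muln0.
have [X [XU Xk] eX] := IH (ltnW ks).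
have [|v /[!inE] /andP[vX vU] big] := @heavy_extension U X XU _ deg.
  by rewrite Xk.
exists (v |: X); first by rewrite subUset sub1set vU XU cardsU1 vX Xk.
have vvX : v \in v |: X by rewrite !inE eqxx.
rewrite (edge_sumD1 w vvX) setU1K //; apply: leq_trans (leq_add eX (leqnn _)).
rewrite /turan_sum big_ord_recr /= -/(turan_sum r a k).
move: big; rewrite Xk /D; set d := degree_in _ _ _ => big.
have := leq_div k r; have := leq_trunc_div k r.
have := ltn_ceil k r_gt0.
move: r_gt0 big; clear; set p := k %/ r; set T := turan_sum _ _ _ => ? ? ? ? ?.
(* Strictness in [big] gives [r * d + k >= r * (a + 1) * (k + 1)]; as [k < r * (p + 1)], dividing by
   [r] loses only [p]. *)
suff : a * k.+1 + k.+1 <= d + p by lia.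
rewrite -ltnS -(ltn_pmul2l (m := r)) //.
nia.
Qed.

(** Otherwise [dense_subset] at [k = s.-1] yields an [s]-set heavier than [q]. *)
Lemma low_degree (U : {set V}) : turan_sum r a s + (s - 1) %/ r > q -> 0 < #|U| ->
  exists2 v, v \in U & r * degree_in w U v <= D * #|U| + r * q.
Proof.
move=> qT U0; case: (boolP [exists (v | v \in U), r * degree_in w U v <= D * #|U| + r * q]).
  by move=> /exists_inP[v]; exists v.
rewrite negb_exists_in => /forall_inP deg.
have [|v vU|X [_ Xs] eX] := @dense_subset U s.-1 U0; first by rewrite prednK.
  by apply: ltnW; rewrite ltnNge; apply: deg.
have eq := sq (etrans Xs (prednK s_gt0)).
move: qT; rewrite -{1}(prednK s_gt0) /turan_sum big_ord_recr /= -/(turan_sum r a s.-1).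
have := leq_div s.-1 r; rewrite subn1; move: eq eX.
set p := _ %/ _; set T := turan_sum _ _ _; lia.
Qed.

(** Low-degree vertices are deleted until [s] remain, and those span at most [q]. The binomial has
    [#|U|.+1] because each deletion costs a multiple of [#|U|], not of [#|U| - 1]. *)
Lemma edge_sum_upper (U : {set V}) : turan_sum r a s + (s - 1) %/ r > q ->
  s <= #|U| -> r * edge_sum w U <= D * 'C(#|U|.+1, 2) + r * q * #|U|.
Proof.
move=> qT; move En : #|U| => n; elim: n U En => [|n IH] U Un.
  by rewrite leqn0 => /eqP s0; move: s_gt0; rewrite s0.
rewrite leq_eqVlt => /orP[/eqP sn|sn].
  have := sq (etrans Un (esym sn)).
  by rewrite -(leq_pmul2l r_gt0) mulnS; lia.
have [|v vU dv] := @low_degree U qT; first by rewrite Un.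
have := IH (U :\ v); rewrite (edge_sumD1 w vU) (binS n.+1) bin1.
have -> : #|U :\ v| = n by move: Un; rewrite (cardsD1 v) vU => -[].
move=> /(_ erefl sn); move: dv; rewrite Un.
set A := edge_sum _ _; set d := degree_in _ _ _; set B := 'C(_, _).
rewrite !mulnDr [r * q * n.+1]mulnS; lia.
Qed.

End Density.

(** * Maxima of sets of naturals *)

Lemma maximum_in (A : set nat) : maximum A = 0%N \/ A (maximum A).
Proof. by rewrite /maximum; case: xgetP => [m _ []|]; [right | left]. Qed.

(** The bound [B] rules out the default value of [xget]. *)
Lemma le_maximum (A : set nat) B k : (forall k, A k -> (k <= B)%N) -> A k ->
  (k <= maximum A)%N.
Proof.
move=> AB Ak; rewrite /maximum; case: xgetP => [m _ [_]|no]; first exact.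
have exA : exists n, `[< A n >] by exists k; apply/asboolP.
have bA n : `[< A n >] -> (n <= B)%N by move=> /asboolP/AB.
exfalso; case: (ex_maxnP exA bA) => m /asboolP Am mmax.
by apply: (no m); split=> // j Aj; apply: mmax; apply/asboolP.
Qed.

(** * Edge sums of blow-ups of the pattern *)

Section BlowUp.
Import boot.fintype boot.finset.
Local Open Scope nat_scope.
Variables (V : finType) (r a : nat).

Lemma T_patE (x y : 'I_r) : T_pat r a [set x; y]%SET = a + (x != y).
Proof. by rewrite /T_pat cards2; case: (x != y); rewrite ?addn1 ?addn0. Qed.

(** By pigeonhole some colour class of [n.+1] vertices has more than [n %/ r] members; a vertex [v]
    of it has at least [n %/ r] others of its own colour, so deleting [v] loses at most the last
    summand of [turan_sum]. *)
Lemma blowup_edge_sum_le (w : multigraph V) (U : {set V}) :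
  is_blowup (T_pat r a) w -> edge_sum w U <= turan_sum r a #|U|.
Proof.
move=> [f wf]; move En : #|U| => n; elim: n U En => [|n IH] U Un.
  by rewrite (cards0_eq Un) edge_sum0.
pose fib (c : 'I_r) := [set u in U | f u == c].
have [c fc] : exists c, n %/ r < #|fib c|.
  apply/existsP; apply: contraT; rewrite negb_exists => /forallP small.
  have : #|U| <= \sum_(c < r) n %/ r.
    rewrite -sum1_card (partition_big f predT) //=.
    apply: leq_sum => c _; move: (small c); rewrite -leqNgt; apply: leq_trans.
    by rewrite sum1dep_card leq_eqVlt; apply/orP; left; apply/eqP/eq_card => u; rewrite !inE.
  by rewrite sum_nat_const card_ord Un leqNgt mulnC ltnS leq_trunc_div.
have [v] : exists v, v \in fib c by apply/set0Pn; rewrite -card_gt0; apply: leq_ltn_trans fc.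
rewrite inE => /andP[vU /eqP fv].
have Uvn : #|U :\ v| = n by move: Un; rewrite (cardsD1 v) vU => -[].
rewrite (edge_sumD1 w vU) /turan_sum big_ord_recr leq_add ?IH //=.
have -> : degree_in w U v = a * n + \sum_(u in U :\ v) (f u != c).
  rewrite -[in a * _]Uvn mulnC -sum_nat_const -big_split /=; apply: eq_bigr => u.
  by rewrite !inE => /andP[uv _]; rewrite wf 1?eq_sym // T_patE fv eq_sym.
rewrite leq_add2l leq_subRL; last first.
  by apply: leq_div.
have : n = \sum_(u in U :\ v) (f u == c) + \sum_(u in U :\ v) (f u != c).
  by rewrite -big_split /= -{1}Uvn -sum1_card; apply: eq_bigr => u _; case: (f u == c).
move=> {2}->; rewrite leq_add2r -big_mkcondr sum1dep_card.
rewrite -ltnS; apply: leq_trans fc _; rewrite (cardsD1 v) inE vU fv eqxx add1n ltnS.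
by apply/subset_leq_card/subsetP => u; rewrite !inE => /and3P[-> -> ->].
Qed.

End BlowUp.

(** Each full period of [r] indices meets the residue once, and the [n %% r] leftover indices miss
    it. *)
Lemma sum_same_residue (r n : nat) : (0 < r)%N ->
  (\sum_(i < n) (i %% r == n %% r) = n %/ r)%N.
Proof.
move=> r0; rewrite -(big_mkord xpredT (fun i => ((i %% r)%N == (n %% r)%N) : nat)).
rewrite [X in index_iota 0 X](divn_eq n r).
have cr := ltn_pmod n r0; move: (n %/ r)%N (n %% r)%N cr => q c cr.
elim: q => [|q IH].
  rewrite mul0n add0n big_nat big1 // => i /andP[_ ic].
  by rewrite modn_small ?(ltn_trans ic) //; apply/eqP; rewrite eqb0; lia.
rewrite mulSn -addnA (big_cat_nat (n := r)) ?leq_addr //=.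
have shift F m : (\sum_(r <= i < r + m) F i = \sum_(0 <= i < m) F (i + r))%N.
  by rewrite -{1}[r]add0n (addnC r) big_addn addnK.
rewrite shift.
rewrite [X in (_ + X)%N](eq_bigr (fun i => ((i %% r)%N == c) : nat)); last by move=> i _; rewrite modnDr.
rewrite IH big_mkord (bigD1 (Ordinal cr)) //= modn_small // eqxx.
rewrite big1 ?addn0 ?addn1 // => i ic; rewrite modn_small //.
by apply/eqP; rewrite eqb0; apply: contraNneq ic => ic; apply/eqP/val_inj.
Qed.

Section ModBlowUp.
Import boot.fintype boot.finset.
Local Open Scope nat_scope.
Variables (r a n : nat).
Hypothesis r_gt0 : 0 < r.

Definition residue (i : 'I_n) : 'I_r := Ordinal (ltn_pmod i r_gt0).

(** The image of a pair is a singleton, hence a loop of the pattern, exactly when both ends have the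
    same residue. *)
Definition mod_blowup : multigraph 'I_n := fun A => T_pat r a (residue @: A).

Lemma mod_blowupP : is_blowup (T_pat r a) mod_blowup.
Proof. by exists residue => u v uv; rewrite /mod_blowup imsetU1 imset_set1. Qed.

(** Adding the vertices in order, vertex [j] meets exactly [j %/ r] earlier ones of its own
    residue. *)
Lemma mod_blowup_edge_sum : edge_sum mod_blowup setT = turan_sum r a n.
Proof.
pose U j := [set i : 'I_n | i < j].
suff H j : j <= n -> edge_sum mod_blowup (U j) = turan_sum r a j.
  by rewrite -(H n) //; congr edge_sum; apply/setP => i; rewrite !inE ltn_ord.
elim: j => [|j IH] jn.
  have -> : U 0 = set0 by apply/setP => i; rewrite !inE.
  by rewrite /turan_sum big_ord0 edge_sum0.
pose v := Ordinal jn; have vU : v \in U j.+1 by rewrite inE /= ltnS.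
have UE : U j.+1 :\ v = U j.
  by apply/setP => i; rewrite !inE -val_eqE /= ltnS ltn_neqAle.
rewrite (edge_sumD1 _ vU) UE IH 1?ltnW // /turan_sum big_ord_recr /=; congr (_ + _).
rewrite /degree_in UE.
have -> : \sum_(u in U j) mod_blowup [set v; u] =
          \sum_(u < n | u < j) (a + (u %% r != j %% r)).
  apply: eq_big => [u|u uj]; first by rewrite inE.
  by rewrite /mod_blowup imsetU1 imset_set1 T_patE -val_eqE /= eq_sym.
rewrite -(big_ord_widen n (fun u => a + (u %% r != j %% r)) (ltnW jn)).
rewrite big_split /= sum_nat_const card_ord mulnC.
congr (_ + _); rewrite -(sum_same_residue j r_gt0).
apply/eqP; rewrite -(eqn_add2r (\sum_(i < j) (i %% r == j %% r))) subnK.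
  rewrite -big_split /= (eq_bigr (fun=> 1)) ?sum1_card ?card_ord //.
  by move=> i _; case: eqP.
by rewrite sum_same_residue // leq_div.
Qed.

End ModBlowUp.

(** Rounding down helps in every summand, since [r * (j %/ r) <= j]. *)
Lemma turan_sum_ge (r a n : nat) : (0 < r)%N ->
  ((a * r + (r - 1)) * 'C(n, 2) <= r * turan_sum r a n)%N.
Proof.
move=> r0; elim: n => [|n IH]; first by rewrite muln0.
rewrite binS bin1 mulnDr /turan_sum big_ord_recr /= mulnDr leq_add //.
have := leq_trunc_div n r; have := leq_div n r; move: (n %/ r)%N => p; nia.
Qed.

Lemma Sigma_T_pat (r a s : nat) : (0 < r)%N ->
  Sigma_pat (T_pat r a) s = turan_sum r a s.
Proof.
move=> r0; pose A := [set edge_sum w [set: 'I_s]%SET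
  | w in [set w : multigraph 'I_s | is_blowup (T_pat r a) w]].
have ub k : A k -> (k <= turan_sum r a s)%N.
  by move=> [w /= bw <-]; rewrite -[in leqRHS](card_ord s) -cardsT blowup_edge_sum_le.
apply/eqP; rewrite eqn_leq; apply/andP; split.
  by rewrite /Sigma_pat -/A; have [->|/ub] := maximum_in A.
apply: (le_maximum ub); exists (mod_blowup a r0); first exact: mod_blowupP.
exact: mod_blowup_edge_sum.
Qed.

(** * From edge sums to edge products *)

Lemma bernoulli_ineq (R : realDomainType) (x : R) n : -1 <= x -> 1 + n%:R * x <= (1 + x) ^+ n.
Proof.
move=> x1; elim: n => [|n IH]; first by rewrite mul0r addr0 expr0.
rewrite exprS; apply: (@le_trans _ _ ((1 + x) * (1 + n%:R * x))); last first.
  by rewrite ler_wpM2l //; lra.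
have : 0 <= n%:R * x ^+ 2 by rewrite mulr_ge0 ?sqr_ge0.
by rewrite -natr1; nra.
Qed.

Section Chord.
Variables (R : realType) (a : nat).
Hypothesis a_gt0 : (0 < a)%N.
(** [ln b] is the slope of the chord of [ln] through [a] and [a + 1]. *)
Let b : R := (a%:R + 1) / a%:R.

Let aR_gt0 : 0 < a%:R :> R. Proof. by rewrite ltr0n. Qed.

Lemma ln_ratio_gt0 : 0 < ln b.
Proof. by rewrite ln_gt0 // /b ltr_pdivlMr // mul1r ltrDl. Qed.

Lemma expR_ln_ratio : expR (ln b) = b.
Proof. by rewrite lnK // posrE divr_gt0 // ltr_wpDl. Qed.

(* On integers, [ln] lies below its chord through [a] and [a + 1]. *)
Lemma nat_le_chord (w : nat) : w%:R <= a%:R * expR ((w%:R - a%:R) * ln b).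
Proof.
rewrite -ler_pdivrMl // mulrC.
(* The goal [w / a <= b ^ (w - a)] is Bernoulli's inequality for [b = 1 + 1/a] if [a <= w];
   otherwise it follows from the one for [b^-1 = 1 - 1/(a + 1)]. The exponential form also covers
   [w = 0]. *)
case: (leqP a w) => [/subnK <-|/ltnW /subnK aw].
  set m := (w - a)%N; rewrite natrD addrK expRM_natl expR_ln_ratio.
  have -> : (m%:R + a%:R) / a%:R = 1 + m%:R * a%:R^-1 :> R by field; rewrite gt_eqF.
  have -> : b = 1 + a%:R^-1 by rewrite /b; field; rewrite gt_eqF.
  by apply: bernoulli_ineq; apply: (@le_trans _ _ 0); rewrite ?invr_ge0 ?oppr_le0.
set m := (a - w)%N in aw; have aE : a%:R = m%:R + w%:R :> R by rewrite -natrD aw.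
have -> : (w%:R - a%:R) * ln b = m%:R * - ln b by rewrite aE; ring.
rewrite expRM_natl expRN expR_ln_ratio.
have -> : b^-1 = 1 + - (a%:R + 1)^-1 by rewrite /b; field; rewrite !gt_eqF //= ltr_wpDl.
apply: le_trans (bernoulli_ineq _ _); last first.
  by rewrite lerN2 invf_le1 ?lerDr ?ltr_wpDl // ltW.
have -> : w%:R / a%:R = 1 - m%:R * a%:R^-1 :> R.
  by rewrite -[in w%:R](addKr m%:R w%:R) -aE; field; rewrite gt_eqF.
rewrite mulrN lerD2l lerN2 ler_wpM2l // lef_pV2 ?posrE ?ltr_wpDl //.
by rewrite lerDl.
Qed.

Lemma chord_eq (w : nat) : w = a \/ w = a.+1 ->
  w%:R = a%:R * expR ((w%:R - a%:R) * ln b).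
Proof.
case=> ->; first by rewrite subrr mul0r expR0 mulr1.
by rewrite -natr1 [a%:R + 1]addrC addrK mul1r expR_ln_ratio /b; field; rewrite gt_eqF.
Qed.

(** The chord is affine in the multiplicity, so the product depends on [w] only through its edge
    sum. *)
Lemma prod_chord n (w : multigraph 'I_n) :
  \prod_(A : {set 'I_n} | #|A| == 2) (a%:R * expR (((w A)%:R - a%:R) * ln b)) =
  a%:R ^+ 'C(n, 2) *
    expR (((edge_sum w [set: 'I_n]%SET)%:R - a%:R * 'C(n, 2)%:R) * ln b) :> R.
Proof.
have cN : #|[pred A : {set 'I_n} | #|A| == 2]| = 'C(n, 2).
  rewrite -[in RHS](card_ord n) -card_draws; apply: eq_card => A.
  by rewrite !inE.
rewrite big_split /= prodr_const cN -expR_sum; congr (_ * expR _).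
rewrite -mulr_suml; congr (_ * _); rewrite sumrB; congr (_ - _).
  rewrite /edge_sum natr_sum; apply: eq_bigl => A.
  by rewrite finset.subsetT.
by rewrite sumr_const cN mulr_natr.
Qed.

Lemma edge_prod_le n (w : multigraph 'I_n) :
  (edge_prod w)%:R <= a%:R ^+ 'C(n, 2) *
    expR (((edge_sum w [set: 'I_n]%SET)%:R - a%:R * 'C(n, 2)%:R) * ln b) :> R.
Proof.
rewrite -prod_chord /edge_prod natr_prod; apply: ler_prod => A _.
by rewrite ler0n nat_le_chord.
Qed.

Lemma edge_prod_eq n (w : multigraph 'I_n) :
  (forall A : {set 'I_n}, #|A| = 2 -> w A = a \/ w A = a.+1) ->
  (edge_prod w)%:R = a%:R ^+ 'C(n, 2) *
    expR (((edge_sum w [set: 'I_n]%SET)%:R - a%:R * 'C(n, 2)%:R) * ln b) :> R.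
Proof.
move=> wa; rewrite -prod_chord /edge_prod natr_prod.
by apply: eq_bigr => A /eqP A2; apply: chord_eq; apply: wa.
Qed.

Lemma powR_root (N : nat) (y : R) : (0 < N)%N ->
  (a%:R ^+ N * expR y) `^ N%:R^-1 = a%:R * expR (y / N%:R).
Proof.
move=> N0; rewrite powRM ?exprn_ge0 ?expR_ge0 // -expRM -powR_mulrn // -powRrM.
by rewrite mulfV ?pnatr_eq0 -?lt0n // powRr1.
Qed.

End Chord.

(** * Squeezing the normalised extremal product *)

Section Limit.
Variables (R : realType) (r a s t : nat).
Hypotheses (r_gt0 : (0 < r)%N) (a_gt0 : (0 < a)%N) (s_gt1 : (1 < s)%N).
Hypothesis t_lt : (t < (s - 1) %/ r)%N.
Let q := (turan_sum r a s + t)%N.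
Let lb : R := ln ((a%:R + 1) / a%:R).
Let c : R := (r%:R - 1) / r%:R.
(** Linear error coefficient: [edge_sum_upper] bounds the edge sum by
    [(a + c) * 'C(n, 2) + K * n]. *)
Let K : R := a%:R + c + q%:R.

Let rR_gt0 : 0 < r%:R :> R. Proof. by rewrite ltr0n. Qed.

Lemma ex_Pi_n_mem n : ex_Pi_n n s q = 0%N \/
  exists2 w : multigraph 'I_n, sq_graph s q w & ex_Pi_n n s q = edge_prod w.
Proof.
rewrite /ex_Pi_n; have [|[w wsq <-]] := maximum_in [set edge_prod w
  | w in [set w : multigraph 'I_n | sq_graph s q w]]; first by left.
by right; exists w.
Qed.

Lemma ex_Pi_n_ge n (w : multigraph 'I_n) : (s <= n)%N -> sq_graph s q w ->
  (edge_prod w <= ex_Pi_n n s q)%N.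
Proof.
move=> sn wsq; apply: (@le_maximum _ (\prod_(A : {set 'I_n} | #|A| == 2) q)); last by exists w.
move=> _ [w' w'sq <-]; apply: leq_prod => A /eqP A2.
by apply: (sq_graph_weight w'sq) => //; rewrite card_ord s_gt1.
Qed.

(** The test graph [mod_blowup] has only multiplicities [a] and [a + 1], where the chord estimate is
    an equality. *)
Lemma root_ex_Pi_n_ge n : (s <= n)%N ->
  a%:R * expR (c * lb) <= (ex_Pi_n n s q)%:R `^ ('C(n, 2)%:R)^-1 :> R.
Proof.
move=> sn; have n1 : (1 < n)%N := leq_trans s_gt1 sn.
have N0 : (0 < 'C(n, 2))%N by rewrite bin_gt0.
have w_sq : sq_graph s q (mod_blowup (n := n) a r_gt0).
  move=> X Xs; apply: leq_trans (blowup_edge_sum_le X (@mod_blowupP r a n r_gt0)) _.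
  by rewrite Xs leq_addr.
have := ex_Pi_n_ge sn w_sq; rewrite -(ler_nat R).
rewrite (edge_prod_eq R a_gt0); last first.
  by move=> A _; rewrite /mod_blowup /T_pat; case: ifP; [left | right].
rewrite mod_blowup_edge_sum => le_ex.
have := ge0_ler_powR (r := ('C(n, 2)%:R)^-1) _ _ _ le_ex.
rewrite powR_root // => ge_root.
apply: le_trans (ge_root _ _ _); rewrite ?invr_ge0 ?nnegrE ?mulr_ge0 ?exprn_ge0 ?expR_ge0 //.
rewrite ler_wpM2l // ler_expR [leRHS]mulrAC ler_wpM2r ?(ltW (ln_ratio_gt0 R a_gt0)) //.
rewrite ler_pdivlMr ?ltr0n // lerBrDr /c -(ler_pM2l rR_gt0).
have := turan_sum_ge a n r_gt0; rewrite -(ler_nat R) !natrM natrD natrM natrB //.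
move: 'C(n, 2)%:R (turan_sum r a n)%:R => N T; apply: le_trans.
by rewrite le_eqVlt; apply/orP; left; apply/eqP; field; rewrite gt_eqF.
Qed.

Lemma root_ex_Pi_n_le n : (s <= n)%N ->
  (ex_Pi_n n s q)%:R `^ ('C(n, 2)%:R)^-1 <=
    a%:R * expR (c * lb) * expR (8 * K * lb * harmonic n) :> R.
Proof.
move=> sn; have n1 : (1 < n)%N := leq_trans s_gt1 sn.
have N0 : (0 < 'C(n, 2))%N by rewrite bin_gt0.
have NR0 : 0 < 'C(n, 2)%:R :> R by rewrite ltr0n.
(* A default value 0 is harmless: the exponent is nonzero, so its power is 0. *)
case: (ex_Pi_n_mem n) => [->|[w wsq ->]].
  by rewrite powR0 ?invr_eq0 ?gt_eqF // !mulr_ge0 ?expR_ge0.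
have := ge0_ler_powR (r := ('C(n, 2)%:R)^-1) _ _ _ (edge_prod_le R a_gt0 w).
rewrite powR_root // => le_root.
apply: le_trans (le_root _ _ _) _;
  rewrite ?invr_ge0 ?nnegrE ?mulr_ge0 ?exprn_ge0 ?expR_ge0 //.
rewrite -mulrA -expRD ler_wpM2l // ler_expR [leLHS]mulrAC.
rewrite (mulrAC (8 * K)) -mulrDl ler_wpM2r ?(ltW (ln_ratio_gt0 R a_gt0)) //.
have s0 : (0 < s)%N by exact: ltnW.
have sV : (s <= #|'I_n|)%N by rewrite card_ord.
have qT : (q < turan_sum r a s + (s - 1) %/ r)%N by rewrite ltn_add2l.
have := edge_sum_upper r_gt0 a_gt0 s0 sV wsq (U := [set: 'I_n]%SET) qT.
rewrite cardsT card_ord => /(_ sn).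
rewrite binS bin1 -(ler_nat R) !(natrD, natrM) natrB //.
move: (edge_sum _ _)%:R => e ub.
have c0 : 0 <= c by rewrite divr_ge0 // subr_ge0 ler1n.
have K0 : 0 <= K by rewrite !addr_ge0.
have {}ub : e <= (a%:R + c) * ('C(n, 2)%:R + n%:R) + q%:R * n%:R.
  rewrite -(ler_pM2l rR_gt0); apply: le_trans ub _; rewrite le_eqVlt; apply/orP; left.
  by apply/eqP; rewrite /c /q natrD; field; rewrite gt_eqF.
rewrite ler_pdivrMr //.
(* With [harmonic n = 1/(n + 1)] this is [n + 1 <= 4 * (n - 1)], true from [n = 2] on; the constant
   8 is not tight. *)
suff : n%:R <= 8 * harmonic n * 'C(n, 2)%:R :> R.
  by move=> /(ler_wpM2l K0); rewrite /K in K0 *; nra.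
rewrite /harmonic /= -mulrA mulrCA mulrC ler_pdivlMr ?ltr0n //.
rewrite -!natrM ler_nat.
have := mul_bin_diag n 1; rewrite bin1; move: n1; clear; move: 'C(n, 2)%N => N.
by case: n => // n; nia.
Qed.

Lemma ex_Pi_limit : ex_Pi R s q = a%:R * expR (c * lb).
Proof.
set L : R := a%:R * expR (c * lb); apply: cvg_lim => //.
apply: (@squeeze_cvgr _ _ _ _ (fun=> L) (fun n =>
   L * expR (8 * K * lb * harmonic n))).
- by exists s => // n /= sn; rewrite root_ex_Pi_n_ge ?root_ex_Pi_n_le.
- exact: cvg_cst.
have h0 : 8 * K * lb * @harmonic R n @[n --> \oo] --> 8 * K * lb * 0.
  by apply: cvgM; [exact: cvg_cst | exact: cvg_harmonic].
have h1 : expR (8 * K * lb * @harmonic R n) @[n --> \oo] --> expR (8 * K * lb * 0).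
  by apply: continuous_cvg h0; exact: continuous_expR.
have h2 := cvgM (cvg_cst L) h1; rewrite mulr0 expR0 mulr1 in h2.
exact: h2.
Qed.

End Limit.

Theorem theorem1p18 (R : realType) (r a s : nat)
    (hr : (1 <= r)%N) (ha : (1 <= a)%N) (hs : (2 * r + 1 <= s)%N) :
  let S := Sigma_pat (T_pat r a) s in
  let tmax := ((s - 1) %/ r - 1)%N in
  (forall t t' : nat, (t <= tmax)%N -> (t' <= tmax)%N ->
     ex_Pi R s (S + t) = ex_Pi R s (S + t')) /\
  (forall t : nat, (t <= tmax)%N ->
     ex_Pi R s (S + t) =
       a%:R * ((a%:R + 1) / a%:R) `^ ((r%:R - 1) / r%:R)).
Proof.
move=> S tmax.
have value t : (t <= tmax)%N ->
    ex_Pi R s (S + t) = a%:R * ((a%:R + 1) / a%:R) `^ ((r%:R - 1) / r%:R).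
  move=> tt; have t_lt : (t < (s - 1) %/ r)%N.
    (* Makes the truncated subtraction in [tmax] exact. *)
    have : (1 <= (s - 1) %/ r)%N by rewrite divn_gt0 //; lia.
    by move: tt; rewrite /tmax; lia.
  have s1 : (1 < s)%N by lia.
  (* [powR] is [expR] of exponent times [ln] only for a nonzero base, hence the positivity goal. *)
  rewrite /S Sigma_T_pat // ex_Pi_limit // /powR gt_eqF //.
  by rewrite divr_gt0 ?ltr_wpDl // ltr0n.
by split=> // t t' tt tt'; rewrite !value.
Qed.
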